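(* Let $(T^{(n)}(\mathcal V),\mathcal G_n,\mathcal P_n)$ be a triple as described in the context, let $\mathcal B$ be a Banach algebra and let $\mathcal H$ be a topological group in $\mathcal B$. Let $g\in C([0,T],\mathcal H)$ and $\beta\in C([0,T],B(\mathcal H,\mathcal G_n))$, and suppose that there exist $M>0$, a control $\omega$ and $\theta>1$ such that $$\max_{\sigma\in\mathcal P_n}\ \sup_{0\le s<t\le T}\|\sigma(\beta_s(g_s,g_{s,t}))\|\le M,$$ $$\max_{\sigma\in\mathcal P_n}\|\sigma((\beta_u-\beta_s)(g_u,g_{u,t}))\|\le \omega(s,t)^{\theta},\qquad \forall\,0\le s<u<t\le T .$$ Then the integral path $\int_0^{\cdot}\beta_u(g_u)\,dg_u\in C([0,T],\mathcal G_n)$ exists (that is, the defining limits exist), and there exists a constant $C_{n,\theta,M,\omega(0,T)}$, depending only on $n,\theta,M,\omega(0,T)$ (for the fixed triple), such that $$\max_{\sigma\in\mathcal P_n}\Big\|\sigma\Big(\int_s^t\beta_u(g_u)\,dg_u\Big)-\sigma\big(\beta_s(g_s,g_{s,t})\big)\Big\|\le C_{n,\theta,M,\omega(0,T)}\,\omega(s,t)^{\theta},\qquad\forall\,0\le s<t\le T .$$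
   Context: **Groups and cocyclic one-forms.** A topological group in a Banach algebra $\mathcal A$ is a subset $\mathcal G\subseteq\mathcal A$ which is a topological group for the unit, multiplication and topology of $\mathcal A$. $L(\mathcal A,\mathcal B)$ is the space of continuous linear maps with the operator norm. For $\beta\in C(\mathcal G,L(\mathcal A,\mathcal B))$ (continuous maps) write $\beta(a,v):=\beta(a)(v)$, $a\in\mathcal G$, $v\in\mathcal A$. If $\mathcal G$ is a topological group in $\mathcal A$ and $\mathcal K$ is a topological group in $\mathcal B$, then $B(\mathcal G,\mathcal K)$ denotes the set of cocyclic one-forms: those $\beta\in C(\mathcal G,L(\mathcal A,\mathcal B))$ with $\beta(a,b)\in\mathcal K$ for all $a,b\in\mathcal G$ and $\beta(a,b)\beta(ab,c)=\beta(a,bc)$ for all $a,b,c\in\mathcal G$. $\beta\in C([0,T],B(\mathcal G,\mathcal K))$ means that $\beta_t\in B(\mathcal G,\mathcal K)$ for every $t$ and $t\mapsto\beta_t(a,\cdot)\in L(\mathcal A,\mathcal B)$ is continuous for every $a\in\mathcal G$. **The triple $(T^{(n)}(\mathcal V),\mathcal G_n,\mathcal P_n)$.** $\mathcal V$ is a Banach space whose tensor powers carry admissible norms: $\|\varrho v\|=\|v\|$ for $v\in\mathcal V^{\otimes k}$ and $\varrho$ in the symmetric group of degree $k$, and $\|u\otimes v\|=\|u\|\|v\|$ for $u\in\mathcal V^{\otimes k},v\in\mathcal V^{\otimes j}$. (1) $T^{(n)}(\mathcal V)$ is a unital associative Banach algebra which as a Banach space equals $\mathbb R\oplus\mathcal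 V\oplus\dots\oplus\mathcal V^{\otimes n}$ with norm $\|v\|=\sum_{k=0}^n\|\pi_k(v)\|$, $\pi_k$ being the projection to $\mathcal V^{\otimes k}$. (2) $\mathcal P_n$ is a finite set of continuous linear maps $\sigma\in L(T^{(n)}(\mathcal V),\mathcal V^{\otimes|\sigma|})$, $|\sigma|\in\{0,1,\dots,n\}$, such that: the projection $\sigma_0$ onto $\mathbb R$ is in $\mathcal P_n$; $\sigma\circ\sigma=\sigma$ for each $\sigma$ and $a=\sum_{\sigma\in\mathcal P_n}\sigma(a)$ for all $a\in T^{(n)}(\mathcal V)$; there is a comultiplication $\triangle:\mathcal P_n\to\mathcal P_n\otimes\mathcal P_n$ with $\triangle\sigma_0=\sigma_0\otimes\sigma_0$ and, for $|\sigma|\ge1$, $\triangle\sigma=\sigma\otimes\sigma_0+\sigma_0\otimes\sigma+\sum_{i=1}^{N(\sigma)}\sigma^{1,i}\otimes\sigma^{2,i}$ with $\sigma^{j,i}\in\mathcal P_n$, $|\sigma^{j,i}|\ge1$, $|\sigma^{1,i}|+|\sigma^{2,i}|=|\sigma|$ (and $N(\sigma)=0$ if $|\sigma|=1$); and the multiplication satisfies $\sigma_0(ab)=\sigma_0(a)\sigma_0(b)$ and, for $|\sigma|\ge1$, $\sigma(ab)=\sigma(a)\sigma_0(b)+\sigma_0(a)\sigma(b)+\sum_{i=1}^{N(\sigma)}\sigma^{1,i}(a)\otimes\sigma^{2,i}(b)$. (3) $\mathcal G_n$ is a closed connected topological group in $T^{(n)}(\mathcal V)$ with $\sigma_0(a)=1$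 for all $a\in\mathcal G_n$. **Control.** A control is a continuous function $\omega:\{0\le s\le t\le T\}\to[0,\infty)$ vanishing on the diagonal with $\omega(s,u)+\omega(u,t)\le\omega(s,t)$ for $s\le u\le t$. **Integral.** $g_{s,t}:=g_s^{-1}g_t$. For $g\in C([0,T],\mathcal H)$, $\beta\in C([0,T],B(\mathcal H,\mathcal G_n))$ and $s<t$, $$\int_s^t\beta_u(g_u)\,dg_u:=\lim_{|D|\to0}\beta_{t_0}(g_{t_0},g_{t_0,t_1})\,\beta_{t_1}(g_{t_1},g_{t_1,t_2})\cdots\beta_{t_{l-1}}(g_{t_{l-1}},g_{t_{l-1},t_l})$$ over finite partitions $D=\{s=t_0<t_1<\dots<t_l=t\}$ with mesh $|D|=\max_k|t_{k+1}-t_k|$, provided the limit exists. *)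

(* Defs.v *)
From HB Require Import structures.
From mathcomp Require Import all_boot all_order all_algebra all_fingroup.
From mathcomp Require Import all_classical all_reals all_analysis.

Set Implicit Arguments.
Unset Strict Implicit.
Unset Printing Implicit Defensive.

Import Order.TTheory GRing.Theory Num.Theory.
Import numFieldNormedType.Exports.

Local Open Scope classical_set_scope.
Local Open Scope ring_scope.

(* Unital Banach algebras, with the zero algebra allowed and no normalization of
   the norm of the unit. The structure carries its own multiplication, since the
   library has no common refinement of its rings and its normed modules, and
   none can be added below [numDomainType]. *)
HB.mixin Record isBanachAlgebra (R : realType) A of CompleteNormedModule R A := {
  bone : A;
  bmul : A -> A -> A;
  bmulA : associative bmul;
  bmul1l : left_id bone bmul;
  bmul1r : right_id bone bmul;
  bmul_linearl : forall y : A, linear (fun x => bmul x y);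
  bmul_linearr : forall x : A, linear (bmul x);
  bmul_norm : forall x y : A, `|bmul x y| <= `|x| * `|y|
}.

#[short(type="banachAlgType")]
HB.structure Definition BanachAlgebra (R : realType) :=
  {A of CompleteNormedModule R A & isBanachAlgebra R A}.

Declare Scope banach_scope.
Delimit Scope banach_scope with B.
Notation "x * y" := (bmul x y) : banach_scope.
Notation "1" := bone : banach_scope.

Definition binverse (R : realType) (A : banachAlgType R) (a : A) : set A :=
  [set b | (a * b = 1)%B /\ (b * a = 1)%B].

(* The inverse of an invertible element; 0 if a is not invertible. *)
Definition binv (R : realType) (A : banachAlgType R) (a : A) : A :=
  xget 0 (binverse a).
Notation "x ^-1" := (binv x) : banach_scope.

Section TensorPowers.
Variables (R : realType) (V : completeNormedModType R).

Definition multilinear (k : nat) (W : lmodType R) (f : k.-tuple V -> W) :=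
  forall (i : 'I_k) (u : k.-tuple V),
    linear (fun x : V => f [tuple if j == i then x else tnth u j | j < k]).

(* [tpow W k] is the k-th tensor power: R, V, and [W j] in degree j + 2. *)
Definition tpow (W : nat -> completeNormedModType R) (k : nat) :
    completeNormedModType R :=
  match k with
  | 0 => R^o
  | 1 => V
  | j.+2 => W j
  end.

(* Banach tensor powers of V with admissible norms: the k-th one is the
   completion, for some norm, of the algebraic tensor power. The algebraic
   tensor power is identified, through its universal property
   ([tmul_universal]), with the linear span of the elementary tensors
   [tmul (v_1, ..., v_k)]; [tmul_dense] says that this span is dense. The maps
   [tens] (tensor product of tensors) and [tact] (action of the symmetric
   group) are determined by their values on elementary tensors. *)
Record tensor_powers := TensorPowers {
  tpow_high : nat -> completeNormedModType R;
  tmul : forall k, k.-tuple V -> tpow tpow_high k;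
  tens : forall j k,
    tpow tpow_high j -> tpow tpow_high k -> tpow tpow_high (j + k)%N;
  tact : forall k, 'S_k -> tpow tpow_high k -> tpow tpow_high k;
  tmul0 : tmul [tuple] = (1 : R);
  tmul1 : forall v : V, tmul [tuple v] = v;
  tmul_multilinear : forall k, multilinear (@tmul k);
  tmul_universal : forall k (W : lmodType R) (f : k.-tuple V -> W),
    multilinear f ->
    forall m (c : 'I_m -> R) (v : 'I_m -> k.-tuple V),
      \sum_(i < m) c i *: tmul (v i) = 0 -> \sum_(i < m) c i *: f (v i) = 0;
  tmul_dense : forall k,
    closure [set x | exists m (c : 'I_m -> R) (v : 'I_m -> k.-tuple V),
                       x = \sum_(i < m) c i *: tmul (v i)] = setT;
  tens_linearl : forall j k (y : tpow tpow_high k),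
    linear (fun x : tpow tpow_high j => tens x y);
  tens_linearr : forall j k (x : tpow tpow_high j),
    linear (fun y : tpow tpow_high k => tens x y);
  tens_tmul : forall j k (u : j.-tuple V) (v : k.-tuple V),
    tens (tmul u) (tmul v) = tmul [tuple of u ++ v];
  tens_norm : forall j k (x : tpow tpow_high j) (y : tpow tpow_high k),
    `|tens x y| = `|x| * `|y|;
  tact_linear : forall k (r : 'S_k), linear (@tact k r);
  tact_tmul : forall k (r : 'S_k) (u : k.-tuple V),
    tact r (tmul u) = tmul [tuple tnth u (r i) | i < k];
  tact_norm : forall k (r : 'S_k) (x : tpow tpow_high k),
    `|tact r x| = `|x|
}.

Definition tensor (E : tensor_powers) (k : nat) : completeNormedModType R :=
  tpow (tpow_high E) k.

End TensorPowers.

Section Groups.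
Variable R : realType.

Definition topological_group (A : banachAlgType R) (G : set A) :=
  [/\ G 1%B,
      forall a b, G a -> G b -> G (a * b)%B,
      forall a, G a -> exists2 b, G b & binverse a b,
      {within G `*` G, continuous (fun p : A * A => p.1 * p.2)%B} &
      {within G, continuous (fun a : A => a^-1)%B}].

Definition opnorm (A B : normedModType R) (f : A -> B) : R :=
  sup [set `|f v| | v in [set v : A | `|v| <= 1]].

(* f is in C(D, L(A, B)), for the operator norm on the space L(A, B) of
   continuous linear maps. *)
Definition continuous_to_L (X : topologicalType) (A B : normedModType R)
    (D : set X) (f : X -> {linear A -> B}) :=
  (forall x, D x -> continuous (f x)) /\
  (forall x, D x ->
     opnorm (fun v => f y v - f x v) @[y --> within D (nbhs x)] --> (0 : R)).

(* The set B(G, K) of cocyclic one-forms; values outside G are irrelevant. *)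
Definition cocyclic (A B : banachAlgType R) (G : set A) (K : set B)
    (beta : A -> {linear A -> B}) :=
  [/\ continuous_to_L G beta,
      forall a b, G a -> G b -> K (beta a b) &
      forall a b c, G a -> G b -> G c ->
        (beta a b * beta (a * b) c = beta a (b * c))%B].

(* beta is in C([0, T], B(G, K)). *)
Definition cocyclic_path (A B : banachAlgType R) (G : set A) (K : set B) (T : R)
    (beta : R -> A -> {linear A -> B}) :=
  (forall t, t \in `[0, T] -> cocyclic G K (beta t)) /\
  (forall a, G a -> continuous_to_L `[0, T] (fun t => beta t a)).

(* g is in C([0, T], G). *)
Definition group_path (A : banachAlgType R) (G : set A) (T : R) (g : R -> A) :=
  (forall t, t \in `[0, T] -> G (g t)) /\ {within `[0, T], continuous g}.

Definition control (T : R) (omega : R -> R -> R) :=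
  [/\ {within [set p : R * R | 0 <= p.1 /\ p.1 <= p.2 /\ p.2 <= T],
        continuous (fun p : R * R => omega p.1 p.2)},
      forall s t, 0 <= s -> s <= t -> t <= T -> 0 <= omega s t,
      forall t, 0 <= t -> t <= T -> omega t t = 0 &
      forall s u t, 0 <= s -> s <= u -> u <= t -> t <= T ->
        omega s u + omega u t <= omega s t].

Definition increment (A : banachAlgType R) (g : R -> A) (s t : R) : A :=
  ((g s)^-1 * g t)%B.

(* As in [itv_partition], a partition s = t_0 < t_1 < ... < t_l = t is given by
   s and the list D = [:: t_1; ...; t_l]. *)
Definition mesh (s : R) (D : seq R) : R :=
  \big[Num.max/0]_(0 <= k < size D) `|nth 0 (s :: D) k.+1 - nth 0 (s :: D) k|.

Definition mesh_to0 (s t : R) : set_system (seq R) :=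
  filter_from [set d : R | 0 < d]
    (fun d => [set D | itv_partition s t D /\ mesh s D < d]).

Definition riemann_prod (A B : banachAlgType R) (beta : R -> A -> {linear A -> B})
    (g : R -> A) (s : R) (D : seq R) : B :=
  let t_ := nth 0 (s :: D) in
  \big[@bmul R B/1%B]_(0 <= k < size D)
    beta (t_ k) (g (t_ k)) (increment g (t_ k) (t_ k.+1)).

Definition integrable_form (A B : banachAlgType R)
    (beta : R -> A -> {linear A -> B}) (g : R -> A) (s t : R) : Prop :=
  cvg (riemann_prod beta g s @ mesh_to0 s t).

(* For s = t the only partition is trivial, and the integral is 1. *)
Definition form_integral (A B : banachAlgType R)
    (beta : R -> A -> {linear A -> B}) (g : R -> A) (s t : R) : B :=
  lim (riemann_prod beta g s @ mesh_to0 s t).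

End Groups.

(* The triple (T^(n)(V), G_n, P_n), where G_n is [tgrp]. *)
Record tensor_triple (R : realType) (V : completeNormedModType R)
    (E : tensor_powers V) (n : nat) := TensorTriple {
  (* T^(n)(V): a Banach algebra which is the l^1 direct sum of the tensor powers
     of degree at most n, with injections [tin] and projections [tpr]
     (meaningful only in degree at most n). *)
  talg : banachAlgType R;
  tin : forall k, {linear tensor E k -> talg};
  tpr : forall k, {linear talg -> tensor E k};
  tpr_in : forall k x, (k <= n)%N -> tpr k (tin k x) = x;
  tpr_in0 : forall j k x, (j <= n)%N -> (k <= n)%N -> j <> k ->
    tpr j (tin k x) = 0;
  tin_sum : forall a, a = \sum_(k < n.+1) tin k (tpr k a);
  talg_norm : forall a, `|a| = \sum_(k < n.+1) `|tpr k a|;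

  (* P_n: the elements of the finite type [tidx] index, without repetition,
     maps [tsig s] in L(T^(n)(V), V^{(x) |s|}), where |s| = [tdeg s]. *)
  tidx : finType;
  tdeg : tidx -> 'I_n.+1;
  tsig : forall s : tidx, {linear talg -> tensor E (tdeg s)};
  tsig_continuous : forall s, continuous (tsig s);
  tsig_inj : forall s s' : tidx,
    existT (fun d : 'I_n.+1 => talg -> tensor E d) (tdeg s) (tsig s) =
    existT (fun d : 'I_n.+1 => talg -> tensor E d) (tdeg s') (tsig s') ->
    s = s';
  tidx0 : tidx;
  tdeg0 : tdeg tidx0 = ord0;
  tsig0 : forall a, tin (tdeg tidx0) (tsig tidx0 a) = tin 0 (tpr 0 a);
  tsig_idem : forall s a, tsig s (tin (tdeg s) (tsig s a)) = tsig s a;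
  tsig_sum : forall a, a = \sum_(s : tidx) tin (tdeg s) (tsig s a);

  (* A list of pairs stands for the formal sum of the corresponding elementary
     tensors in P_n (x) P_n; [tcored s] lists (s^{1,i}, s^{2,i}), i <= N(s). *)
  tcomul : tidx -> seq (tidx * tidx);
  tcored : tidx -> seq (tidx * tidx);
  tcomul0 : tcomul tidx0 = [:: (tidx0, tidx0)];
  tcomulE : forall s, (1 <= tdeg s)%N ->
    tcomul s = [:: (s, tidx0), (tidx0, s) & tcored s];
  tcored_deg : forall s p, (1 <= tdeg s)%N -> p \in tcored s ->
    [/\ (1 <= tdeg p.1)%N, (1 <= tdeg p.2)%N & (tdeg p.1 + tdeg p.2 = tdeg s)%N];
  tcored1 : forall s, tdeg s = 1%N :> nat -> tcored s = [::];

  (* The real number sigma_0 a is [tpr 0 a]. The injections [tin] turn the last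
     equation, whose summands have propositionally equal degrees, into an
     equation in the algebra. *)
  tsig0M : forall a b, tpr 0 (a * b)%B = (tpr 0 a : R) * (tpr 0 b : R);
  tsigM : forall s a b, (1 <= tdeg s)%N ->
    tin (tdeg s) (tsig s (a * b)%B) =
      (tpr 0 b : R) *: tin (tdeg s) (tsig s a)
      + (tpr 0 a : R) *: tin (tdeg s) (tsig s b)
      + \sum_(p <- tcored s)
          tin (tdeg p.1 + tdeg p.2)%N (tens (tsig p.1 a) (tsig p.2 b));

  tgrp : set talg;
  tgrp_group : topological_group tgrp;
  tgrp_closed : closed tgrp;
  tgrp_connected : connected tgrp;
  tgrp_sig0 : forall a, tgrp a -> tpr 0 a = (1 : R)
}.

Arguments tgrp {R V E n} t _.

Definition max_sig (R : realType) (V : completeNormedModType R)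
    (E : tensor_powers V) (n : nat) (X : tensor_triple E n) (a : talg X) : R :=
  \big[Num.max/0]_(s : tidx X) `|tsig s a|.

(* max over sigma of |sigma(a) - sigma(b)| *)
Definition max_sig_dist (R : realType) (V : completeNormedModType R)
    (E : tensor_powers V) (n : nat) (X : tensor_triple E n) (a b : talg X) : R :=
  \big[Num.max/0]_(s : tidx X) `|tsig s a - tsig s b|.

(* Main.v *)
Require Import Defs.
From HB Require Import structures.
From mathcomp Require Import all_boot all_order all_algebra all_fingroup.
From mathcomp Require Import all_classical all_reals all_analysis.
From mathcomp Require Import lra ring.
Import Order.TTheory GRing.Theory Num.Theory.
Import numFieldNormedType.Exports.
Local Open Scope classical_set_scope.
Local Open Scope ring_scope.

(** The increments [gam s t := beta s (g s) (increment g s t)] are almost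
    multiplicative in the Banach algebra [talg X]: as [beta s] is cocyclic,
      [gam s u * gam u t - gam s t =
         gam s u * (beta u (g u) _ - beta s (g u) _)],
    which is [O(omega s t `^ theta)], and the [gam s t] are uniformly bounded.
    The theorem is therefore a sewing lemma for non-commuting factors.

    Deleting from a partition with [l] intervals a point whose two neighbouring
    intervals carry at most [2 * omega s t / (l - 1)] of the control
    ([control_drop]) changes the product by [O((omega s t / (l - 1)) `^ theta)],
    provided the products over the subpartitions on both sides are bounded; as
    [theta > 1] these errors are summable, whence the product over the whole
    partition is within [C * omega s t `^ theta] of [gam s t]
    ([sewing_of_bounded]). In a general Banach algebra submultiplicativity of
    the norm does not bound the products. When [omega s t] is below a threshold
    the same estimate gives the bound, by induction on the number of points
    ([oprod_le_local]); in general, the partition is cut greedily into at most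
    [omega 0 T / threshold + 1] such pieces and single intervals ([oprod_le]).
    The graded structure of the tensor algebra is not needed for this.

    With products bounded, refining a partition whose intervals all satisfy
    [omega <= eps] changes the product by [O(eps `^ (theta - 1) * omega s t)]
    ([oprod_refine_le]), so the products form a Cauchy filter as the mesh tends
    to 0. The limit stays in the closed group [tgrp X], and satisfies the same
    estimate against [gam s t].

    Continuity of the integral path is delicate at the left of a time [t],
    because [(s, a) |-> beta s a] is not assumed to be jointly continuous. It
    is obtained by comparing the integrals up to [t] and [t'] through a fixed
    base point [s] slightly before both ([oprod_lim_dist]): the two remainders
    are small with the control, and [gam s t'] is continuous in [t'].

    Finally, the norm of [talg X] and [max_sig] are equivalent, because the
    finitely many maps [tsig s] are bounded and sum to the identity. *)

Set Implicit Arguments.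
Unset Strict Implicit.
Unset Printing Implicit Defensive.

(* The delimiting key is also that of the Boolean scope. *)
Delimit Scope banach_scope with B.

(** * Multiplication in Banach algebras *)

Section BanachAlgebra.
Variables (R : realType) (A : banachAlgType R).
Implicit Types x y z : A.

Lemma bmulBl x y z : ((x - y) * z)%B = (x * z)%B - (y * z)%B.
Proof.
have := bmul_linearl z (-1) y x.
by rewrite /= !scaleN1r => h; rewrite (addrC x) h addrC.
Qed.

Lemma bmulBr x y z : (x * (y - z))%B = (x * y)%B - (x * z)%B.
Proof.
have := bmul_linearr x (-1) z y.
by rewrite /= !scaleN1r => h; rewrite (addrC y) h addrC.
Qed.

Lemma bmul_norm_le x y a b : `|x| <= a -> `|y| <= b -> `|(x * y)%B| <= a * b.
Proof.
move=> xa yb; apply: (le_trans (bmul_norm x y)).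
by apply: ler_pM.
Qed.

Lemma bmul_continuousr x : continuous (bmul x).
Proof.
move=> y; apply/cvgrPdist_le => e e0.
have d0 : 0 < e / (`|x| + 1) by rewrite divr_gt0 // ltr_wpDl.
near=> z.
rewrite -bmulBr; apply: (le_trans (bmul_norm _ _)).
have : `|y - z| <= e / (`|x| + 1).
  by near: z; apply: cvgr_dist_le => //; exact: cvg_id.
rewrite ler_pdivlMr ?ltr_wpDl// => h; apply: le_trans h.
by rewrite mulrC ler_wpM2l// lerDl.
Unshelve. all: by end_near. Qed.

End BanachAlgebra.

(** * Partitions *)

Section Partitions.
Variable R : realType.
Implicit Types (s t u d : R) (D : seq R).

Lemma itv_partition_catP s t D1 D2 :
  itv_partition s t (D1 ++ D2) <->
  itv_partition s (last s D1) D1 /\ itv_partition (last s D1) t D2.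
Proof.
rewrite /itv_partition cat_path last_cat eqxx; split.
  by move=> [/andP[-> ->] ->].
by move=> [[-> _] [-> ->]].
Qed.

Lemma itv_partition_consP s t u D :
  itv_partition s t (u :: D) <-> s < u /\ itv_partition u t D.
Proof.
rewrite /itv_partition /=; split; first by move=> [/andP[-> ->] ->].
by move=> [-> [-> ->]].
Qed.

Lemma itv_partition_mem s t D u : itv_partition s t D -> u \in D -> s < u <= t.
Proof.
elim: D s => // v D IH s /itv_partition_consP[sv vt].
rewrite inE => /predU1P[->|uD]; first by rewrite sv (itv_partition_le vt).
by have /andP[vu ->] := IH _ vt uD; rewrite (lt_trans sv vu).
Qed.

(** The first point of a list at which a property of its starting point
    fails. *)
Lemma split_first (P : pred R) s D : P s -> ~~ P (last s D) ->
  exists D1 u D2, [/\ D = D1 ++ u :: D2, P (last s D1) & ~~ P u].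
Proof.
elim: D s => [|u D IH] s Ps /=; first by rewrite Ps.
move=> nP; have [Pu|nPu] := boolP (P u); last by exists [::], u, D.
by have [D1 [v [D2 [-> h1 h2]]]] := IH u Pu nP; exists (u :: D1), v, D2.
Qed.

(** The form of the mesh condition that is stable under concatenation and
    amenable to induction on the list of points. *)
Lemma mesh_lt s D d : 0 < d ->
  (mesh s D < d) = path (fun x y => `|y - x| < d) s D.
Proof.
move=> d0; elim: D s => [|u D IH] s; first by rewrite /mesh big_geq.
have -> : mesh s (u :: D) = Num.max `|u - s| (mesh u D).
  by rewrite /mesh /= big_nat_recl.
by rewrite gt_max IH.
Qed.

Lemma itv_partition_fine s t d : s <= t -> 0 < d ->
  exists D, itv_partition s t D /\ mesh s D < d.
Proof.
move=> st d0; set h := d / 2; have h0 : 0 < h by rewrite divr_gt0.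
have hd : h < d by rewrite /h; lra.
suff key (N : nat) : forall s, s <= t -> t - s <= N%:R * h ->
    exists D, itv_partition s t D /\ mesh s D < d.
  by apply: (key (Num.truncn ((t - s) / h)).+1 s st);
    rewrite -ler_pdivrMr// ltW// truncnS_gt.
elim: N => [|N IH] {}s {}st le.
  have -> : s = t by move: le; rewrite mul0r; lra.
  by exists [::]; rewrite mesh_lt//; split => //; split.
have [le_h|lt_h] := leP (t - s) h; last first.
  have [||D [part mD]] := IH (s + h); first by lra.
    by move: le; rewrite -natr1 mulrDl mul1r; lra.
  exists (s + h :: D); rewrite itv_partition_consP ltrDl; split => //.
  by move: mD; rewrite !mesh_lt//= => ->; rewrite addrC addKr gtr0_norm// hd.
move: st; rewrite le_eqVlt => /predU1P[->|lt_st].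
  by exists [::]; rewrite mesh_lt//; split => //; split.
exists [:: t]; rewrite itv_partition_consP mesh_lt//=; split => //.
by rewrite andbT ger0_norm ?subr_ge0 ?ltW//; exact: le_lt_trans hd.
Qed.

Lemma mesh_to0_proper s t : s <= t -> ProperFilter (mesh_to0 s t).
Proof.
move=> st; apply: filter_from_proper; last first.
  by move=> d d0; have [D] := itv_partition_fine st d0; exists D.
apply: filter_from_filter; first by exists 1 => /=.
move=> d1 d2 /= d10 d20; exists (Num.min d1 d2); first by rewrite lt_min d10.
by move=> D [part]; rewrite lt_min => /andP[].
Qed.

Lemma itv_partition_common s t D1 D2 :
  itv_partition s t D1 -> itv_partition s t D2 ->
  exists D, [/\ itv_partition s t D, {subset D1 <= D} & {subset D2 <= D}].
Proof.
move=> part1 part2.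
have [D1nil|D1n] := eqVneq D1 [::].
  by exists D2; split => // x; rewrite D1nil.
pose D := sort <=%R (undup (D1 ++ D2)).
have memD x : (x \in D) = (x \in D1) || (x \in D2).
  by rewrite mem_sort mem_undup mem_cat.
exists D; split; last 2 first.
- by move=> x; rewrite memD => ->.
- by move=> x; rewrite memD orbC => ->.
have sD : path <%R s D.
  rewrite lt_path_sortedE sort_lt_sorted undup_uniq andbT.
  apply/allP => x; rewrite memD.
  case/orP => [/(itv_partition_mem part1)|/(itv_partition_mem part2)];
    by case/andP.
split => //; rewrite eq_le.
have tD1 : t \in D1.
  case: part1 => _ /eqP; case: (D1) D1n => // v D' _ /= <-; exact: mem_last.
have tD : t \in D by rewrite memD tD1.
have partD : itv_partition s (last s D) D by split.
have /andP[_ ->] := itv_partition_mem partD tD; rewrite andbT.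
have : last s D \in D by case: (D) tD => // v D' _; rewrite /= mem_last.
rewrite memD.
case/orP => [/(itv_partition_mem part1)|/(itv_partition_mem part2)];
  by case/andP.
Qed.

End Partitions.

(** * Controls *)

Section Control.
Variables (R : realType) (T : R) (omega : R -> R -> R).
Hypothesis omegaP : control T omega.
Implicit Types (s t u : R) (D : seq R).

Lemma control_mono s p q t : 0 <= s -> s <= p -> p <= q -> q <= t -> t <= T ->
  omega p q <= omega s t.
Proof.
move=> s0 sp pq qt tT; have [_ h0 _ h] := omegaP.
have p0 := le_trans s0 sp; have qT := le_trans qt tT.
have pt := le_trans pq qt; have sq := le_trans sp pq.
have := h s p t s0 sp pt tT; have := h p q t p0 pq qt tT.
have := h0 s p s0 sp (le_trans pt tT); have := h0 q t (le_trans p0 pq) qt tT.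
lra.
Qed.

(** By superadditivity, the control summed over all pairs of neighbouring
    intervals of a partition is at most [2 * omega s t]; hence some pair
    carries at most the average, and so at most [c]. *)
Lemma control_drop s t D c :
  0 <= s -> t <= T -> itv_partition s t D -> (1 < size D)%N ->
  2 * omega s t <= c * (size D).-1%:R ->
  exists D1 u v D2, D = D1 ++ u :: v :: D2 /\ omega (last s D1) v <= c.
Proof.
move=> s0 tT; have [_ om0 omid omD] := omegaP.
(* Induction on the partition, with [omega s t + omega u t] as an upper bound
   for the total over the pairs of neighbouring intervals. *)
suff key : forall D s u, 0 <= s -> itv_partition s t (u :: D) ->
    (0 < size D)%N -> omega s t + omega u t <= c * (size D)%:R ->
    exists D1 v w D2, u :: D = D1 ++ v :: w :: D2 /\ omega (last s D1) w <= c.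
  case: D => // u D part szD le; apply: (key D s u s0 part szD).
  apply: le_trans le; move/itv_partition_consP: part => [su ut].
  have := control_mono s0 (ltW su) (itv_partition_le ut) (lexx t) tT; lra.
move=> {s0 D}D; elim: D {s} => // v D IH s u s0 part _ le.
have [lec|ltc] := leP (omega s v) c; first by exists [::], u, v, D.
move: (part) => /itv_partition_consP[su /itv_partition_consP[uv vt]].
have vleT := itv_partition_le vt; have u0 := le_trans s0 (ltW su).
have sv := lt_trans su uv; have v0 := le_trans s0 (ltW sv).
have omsv := omD s v t s0 (ltW sv) vleT tT.
have szD : (0 < size D)%N.
  rewrite lt0n; apply/negP => /nilP D0; move: le; rewrite D0 /= mulr1.
  have := om0 u t u0 (le_trans (ltW uv) vleT) tT.
  by have := om0 v t v0 vleT tT; lra.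
have upart : itv_partition u t (v :: D) by apply/itv_partition_consP.
have le' : omega u t + omega v t <= c * (size D)%:R.
  by move: le; rewrite /= -natr1 mulrDr mulr1; lra.
have [D1 [p [q [D2 [-> leq]]]]] := IH u v u0 upart szD le'.
by exists (u :: D1), p, q, D2.
Qed.

End Control.

(** A control is uniformly small near the diagonal, by compactness of
    [`[0, T]]. *)
Lemma control_small (R : realType) (T : R) (omega : R -> R -> R) (eps : R) :
  control T omega -> 0 < eps ->
  exists2 d : R, 0 < d & forall s t, 0 <= s -> s <= t -> t <= T -> t - s < d ->
    omega s t <= eps.
Proof.
move=> [/subspace_continuousP omc _ om0 _] eps0.
have cpt := @segment_compact R 0 T.
have : \forall d \near 0^'+, `[0, T] `<=`
    [set s | forall t : R, 0 <= s -> s <= t -> t <= T -> t - s < d ->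
      omega s t <= eps].
  apply: ((compact_near_coveringP _).1 cpt) => x.
  rewrite /= in_itv /= => /andP[x0 xT].
  have /= := omc (x, x); rewrite lexx => /(_ (conj x0 (conj isT xT))).
  move=> /cvgrPdist_le/(_ _ eps0); rewrite near_withinE.
  move=> [[U V] /= [/nbhs_ballP[e1 /= e10 U1] /nbhs_ballP[e2 /= e20 V2]] UV].
  exists (ball x (Num.min e1 (e2 / 2)), [set d | d < e2 / 2]) => /=.
    split; first by apply: nbhsx_ballx; rewrite lt_min e10 divr_gt0.
    by apply: nbhs_right_lt; rewrite divr_gt0.
  move=> [s d] /= [xs dlt] t s0 st tT std.
  move: xs; rewrite /ball /= lt_min => /andP[xs1 xs2].
  have := UV (s, t) (conj (U1 s xs1) (V2 t _)) => /=.
  rewrite /from_subspace /= om0// sub0r normrN => h.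
  apply: (le_trans (ler_norm _)); apply: h => //.
  rewrite /ball /= -(subrK s x) -addrA; apply: (le_lt_trans (ler_normD _ _)).
  rewrite (distrC s t) (ger0_norm (x := t - s)) ?subr_ge0//.
  by move: xs2; lra.
move=> /(filterI (@nbhs_right_gt R 0)) /filter_ex[d [d0 h]].
exists d => // s t s0 st tT; apply: h => //=.
by rewrite in_itv /= s0 (le_trans st).
Qed.

(** * Sums of negative powers *)

Section PowerSeries.
Variable R : realType.
Implicit Types theta : R.

(** An upper bound for the sum of [j `^ (- theta)] over all [j >= 1], from
    comparison with the integral. *)
Definition zeta_bound theta : R := 1 + (theta - 1)^-1.

(** The comparison of [k.+1 `^ (- theta)] with the integral of
    [x `^ (- theta)] over [[k, k.+1]], obtained from [1 + x <= expR x]. *)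
Lemma powRN_telescope theta (k : nat) : 1 < theta -> (0 < k)%N ->
  (theta - 1) * k.+1%:R `^ (- theta) <=
  k%:R `^ (1 - theta) - k.+1%:R `^ (1 - theta).
Proof.
move=> th k0; set a := theta - 1; have a0 : 0 < a by rewrite /a; lra.
set x : R := k%:R; have x0 : 0 < x by rewrite /x ltr0n.
have -> : k.+1%:R = x + 1 by rewrite -natr1.
have x10 : 0 < x + 1 by lra.
have -> : 1 - theta = - a by rewrite /a; lra.
have -> : - theta = - a + - 1 by rewrite /a; lra.
rewrite powRD; last by rewrite (gt_eqF x10) implybT.
rewrite (powR_inv1 (ltW x10)).
have xE : x = (x + 1) * (x / (x + 1)) by field; rewrite gt_eqF.
have r0 : 0 < x / (x + 1) by rewrite divr_gt0.
have -> : x `^ (- a) = (x + 1) `^ (- a) * (x / (x + 1)) `^ (- a).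
  by rewrite -powRM ?ltW// -xE.
have p0 : 0 < (x + 1) `^ (- a) by rewrite powR_gt0.
(* Both sides have the factor [(x + 1) `^ (- a)]. *)
suff : 1 + a / (x + 1) <= (x / (x + 1)) `^ (- a).
  move=> h; have := ler_wpM2l (ltW p0) h; rewrite mulrDr mulr1.
  set P := (x + 1) `^ (- a); set Q := (x / (x + 1)) `^ (- a).
  have -> : P * (a / (x + 1)) = a * (P * (x + 1)^-1) by ring.
  lra.
rewrite /powR (gt_eqF r0); apply: le_trans (expR_ge1Dx _).
rewrite lerD2l -(mulrN1 a) -mulrA (ler_wpM2l (ltW a0))//.
have i1 : (x + 1)^-1 < 1 by rewrite invf_lt1//; lra.
have : ln (1 + - (x + 1)^-1) <= - (x + 1)^-1 by rewrite le_ln1Dx// ltrN2.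
have -> : 1 + - (x + 1)^-1 = x / (x + 1) by field; rewrite gt_eqF.
by rewrite mulN1r lerNr.
Qed.

Lemma sum_powRN_le theta (k : nat) : 1 < theta ->
  \sum_(1 <= j < k) j%:R `^ (- theta) <= zeta_bound theta.
Proof.
move=> th; have a0 : 0 < theta - 1 by lra.
have ai0 : 0 < (theta - 1)^-1 by rewrite invr_gt0.
have [k2|k2] := leqP k 1.
  by rewrite big_geq// /zeta_bound; lra.
suff : \sum_(1 <= j < k) j%:R `^ (- theta) <=
    1 + (theta - 1)^-1 * (1 - k.-1%:R `^ (1 - theta)).
  move=> /le_trans; apply; rewrite /zeta_bound lerD2l.
  by apply: ler_piMr; rewrite ?gerBl ?powR_ge0 ?ltW.
case: k k2 => // k k1; rewrite ltnS in k1; rewrite /=.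
elim: k k1 => // k IH _; have [->|k0] := posnP k.
  by rewrite big_nat1 !powR1 subrr mulr0 addr0.
rewrite big_nat_recr//=; apply: (le_trans (lerD (IH k0) (lexx _))).
have := powRN_telescope th k0; rewrite -(ler_pM2l ai0) mulrA mulVf ?gt_eqF//.
by rewrite mul1r; lra.
Qed.

End PowerSeries.

(** * Ordered products along a partition *)

Section OrderedProducts.
Variables (R : realType) (A : banachAlgType R) (gam : R -> R -> A).
Implicit Types (s t u : R) (D : seq R).

(** The product of the [gam t_k t_(k+1)], in this order, along the points
    [t_0 = s] and [D = [:: t_1; ...; t_l]]. *)
Fixpoint oprod s D : A :=
  if D is u :: D' then (gam s u * oprod u D')%B else 1%B.

Lemma oprod_cat s D1 D2 :
  oprod s (D1 ++ D2) = (oprod s D1 * oprod (last s D1) D2)%B.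
Proof.
elim: D1 s => [|u D1 IH] s /=; first by rewrite bmul1l.
by rewrite IH bmulA.
Qed.

End OrderedProducts.

(** * The sewing lemma *)

Section SewingConstants.
Variable R : realType.
Implicit Types theta K L M W : R.

(** The constant of the sewing estimate when all partial products have norm at
    most [L]; [K] is the constant of almost multiplicativity. *)
Definition sewing_const theta K L : R :=
  L ^+ 2 * K * 2 `^ theta * zeta_bound theta.

(** The threshold on the control under which [2 * M] bounds all products, [M]
    being a bound for the factors: it solves
    [sewing_const theta K (2 * M) * x `^ theta = M]. *)
Definition sewing_scale theta K M : R :=
  (4 * M * K * 2 `^ theta * zeta_bound theta)^-1 `^ theta^-1.

(** The bound for the products along a partition of total control [W]: such a
    partition consists of at most [W / sewing_scale theta K M + 1] pairs of a
    piece below the threshold and a single interval, and of a last piece below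
    the threshold. *)
Definition oprod_bound theta K M W : R :=
  2 * M * (2 * M ^+ 2) ^+ (Num.truncn (W / sewing_scale theta K M)).+1.

End SewingConstants.

Section Sewing.
Variables (R : realType) (A : banachAlgType R) (T : R) (omega : R -> R -> R).
Variables (theta M K : R) (gam : R -> R -> A).
Hypotheses (omegaP : control T omega) (theta_gt1 : 1 < theta).
Hypotheses (M_ge1 : 1 <= M) (K_gt0 : 0 < K) (bone_le : `|1%B : A| <= M).
Hypothesis gam_le : forall s t : R, 0 <= s -> s < t -> t <= T ->
  `|gam s t| <= M.
Hypothesis gam_almost : forall s u t : R, 0 <= s -> s < u -> u < t -> t <= T ->
  `|(gam s u * gam u t)%B - gam s t| <= K * omega s t `^ theta.
Implicit Types (s t u : R) (D : seq R).

Local Notation oprod := (oprod gam).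

Let omega_ge0 s t : 0 <= s -> s <= t -> t <= T -> 0 <= omega s t.
Proof. by move: omegaP => [_ + _ _]; exact. Qed.

Let theta_ge0 : 0 <= theta. Proof. by move: theta_gt1; lra. Qed.

Let zeta_gt0 : 0 < zeta_bound theta.
Proof. by rewrite /zeta_bound addr_gt0// invr_gt0 subr_gt0. Qed.

(** The effect of deleting one point [u] from a partition. *)
Lemma oprod_drop_le s D1 u v D2 t L c :
  0 <= s -> t <= T -> itv_partition s t (D1 ++ u :: v :: D2) ->
  `|oprod s D1| <= L -> `|oprod v D2| <= L ->
  omega (last s D1) v <= c ->
  `|oprod s (D1 ++ u :: v :: D2) - oprod s (D1 ++ v :: D2)| <=
    L ^+ 2 * K * c `^ theta.
Proof.
move=> s0 tT /itv_partition_catP[] /itv_partition_le.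
set p := last s D1 => sp.
move=> /itv_partition_consP[pu] /itv_partition_consP[uv] /itv_partition_le vt.
move=> le1 le2 lec.
have p0 := le_trans s0 sp; have vT := le_trans vt tT.
have c0 : 0 <= c.
  by apply: le_trans lec; apply: omega_ge0 => //; apply/ltW/(lt_trans pu).
rewrite !oprod_cat -bmulBr /= -/p bmulA -bmulBl.
have -> : L ^+ 2 * K * c `^ theta = L * (K * c `^ theta * L) by ring.
apply: bmul_norm_le => //; apply: bmul_norm_le => //.
apply: (le_trans (gam_almost p0 pu uv vT)).
rewrite ler_pM2l//; apply: ge0_ler_powR => //; rewrite nnegrE//.
by apply: omega_ge0 => //; apply/ltW/(lt_trans pu).
Qed.

(** The sewing estimate, from an a priori bound [L] on the products along all
    strictly shorter partitions of small control: points are deleted one at a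
    time until no interior point is left. *)
Lemma sewing_of_bounded L delta (l : nat) :
  (forall s t D, 0 <= s -> t <= T -> itv_partition s t D -> (size D < l)%N ->
    omega s t <= delta -> `|oprod s D| <= L) ->
  forall s t D, 0 <= s -> t <= T -> itv_partition s t D ->
    (0 < size D <= l)%N -> omega s t <= delta ->
    `|oprod s D - gam s t| <= sewing_const theta K L * omega s t `^ theta.
Proof.
move=> bnd s t D s0 tT part /andP[szD szl] le_delta.
have st := itv_partition_le part; have om0 := omega_ge0 s0 st tT.
(* Going from [j.+1] to [j] intervals costs a multiple of [j `^ (- theta)]. *)
suff : `|oprod s D - gam s t| <= L ^+ 2 * K * 2 `^ theta *
    (\sum_(1 <= j < size D) j%:R `^ (- theta)) * omega s t `^ theta.
  move=> /le_trans; apply; apply: ler_wpM2r; first exact: powR_ge0.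
  apply: ler_wpM2l; last exact: sum_powRN_le.
  by rewrite mulr_ge0 ?powR_ge0// mulr_ge0 ?sqr_ge0// ltW.
have [k szE] : exists k, size D = k.+1 by exists (size D).-1; rewrite prednK.
rewrite szE; elim: k D szE part szl {szD} => [|k IH] D szE part szl.
  rewrite big_geq// mulr0 mul0r normr_le0 subr_eq0.
  case: D szE part {szl} => // u [|//] _ [_ /= /eqP ->].
  by rewrite bmul1r.
have k0 : (0 : R) < k.+1%:R by rewrite ltr0n.
have [||D1 [u [v [D2 [DE lec]]]]] :=
    @control_drop _ _ _ omegaP s t D (2 * omega s t / k.+1%:R) s0 tT part.
- by rewrite szE.
- by rewrite szE /= divfK// gt_eqF.
move: part szE szl; rewrite DE => part szE szl.
have sz' : size (D1 ++ v :: D2) = k.+1.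
  by apply/succn_inj; rewrite -szE !size_cat /= !addnS.
have [part1 /itv_partition_consP[pu /itv_partition_consP[uv part2]]] :=
  (itv_partition_catP s t D1 (u :: v :: D2)).1 part.
have part' : itv_partition s t (D1 ++ v :: D2).
  apply/itv_partition_catP; split => //.
  by apply/itv_partition_consP; split => //; exact: lt_trans uv.
have sp := itv_partition_le part1; have vt := itv_partition_le part2.
have pv := ltW (lt_trans pu uv); have pt := le_trans pv vt.
have drop : `|oprod s (D1 ++ u :: v :: D2) - oprod s (D1 ++ v :: D2)| <=
    L ^+ 2 * K * (2 * omega s t / k.+1%:R) `^ theta.
  apply: oprod_drop_le part _ _ lec => //.
  - apply: (bnd s (last s D1)) => //; first exact: le_trans tT.
      by apply: leq_trans szl; rewrite size_cat /= !addnS ltnS leqW ?leq_addr.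
    by apply: le_trans le_delta; apply: (control_mono omegaP s0).
  - apply: (bnd v t) => //.
    + by apply: le_trans pv; apply: le_trans sp.
    + by apply: leq_trans szl; rewrite size_cat /= !addnS ltnS leqW ?leq_addl.
    + by apply: le_trans le_delta; apply: (control_mono omegaP s0) => //;
      exact: le_trans pv.
have szl' : (size (D1 ++ v :: D2) <= l)%N.
  by apply: leq_trans szl; rewrite szE sz'.
have := IH _ sz' part' szl'.
rewrite (@big_nat_recr _ _ _ k.+1)//= => le'.
apply: (le_trans (ler_distD (oprod s (D1 ++ v :: D2)) _ _)).
apply: (le_trans (lerD drop le')).
have -> : (2 * omega s t / k.+1%:R) `^ theta =
    2 `^ theta * omega s t `^ theta * k.+1%:R `^ (- theta).
  rewrite powRM ?invr_ge0 ?mulr_ge0// powRM//; congr (_ * _).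
  by rewrite -powR_inv1// -powRrM mulN1r.
rewrite [in leRHS]mulrDr mulrDl; lra.
Qed.

(** Below the threshold, the a priori bound required by [sewing_of_bounded]
    comes by induction on the number of points. *)
Lemma oprod_le_local s t D : 0 <= s -> t <= T -> itv_partition s t D ->
  omega s t <= sewing_scale theta K M -> `|oprod s D| <= 2 * M.
Proof.
have [l] := ubnP (size D); elim: l s t D => // l IH s t D szl s0 tT part le.
have [/size0nil ->|Dn] := posnP (size D).
  by rewrite /=; move: bone_le M_ge1; lra.
have st : s < t.
  by apply: itv_partition_size_neq0 part.
have h : `|oprod s D - gam s t| <= M; last first.
  rewrite -(subrK (gam s t) (oprod s D)); apply: (le_trans (ler_normD _ _)).
  by have := gam_le s0 st tT; lra.
have bnd := @sewing_of_bounded (2 * M) (sewing_scale theta K M) l _ s t D s0 tT.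
apply: (le_trans (bnd _ part _ le)); last 1 first.
- rewrite /sewing_const.
  have Z0 := zeta_gt0; set Z := zeta_bound theta in Z0 *.
  have t0 : 0 < 2 `^ theta :> R by rewrite powR_gt0.
  have M0 : 0 < M by exact: lt_le_trans M_ge1.
  have X0 : 0 < 4 * M * K * 2 `^ theta * Z by rewrite !mulr_gt0.
  have : omega s t `^ theta <= (4 * M * K * 2 `^ theta * Z)^-1.
    have om0 := omega_ge0 s0 (ltW st) tT.
    have sc0 : 0 <= sewing_scale theta K M by exact: powR_ge0.
    have := ge0_ler_powR theta_ge0 _ _ le; rewrite !nnegrE => /(_ om0 sc0).
    rewrite /sewing_scale -powRrM mulVf ?(gt_eqF (lt_trans ltr01 theta_gt1))//.
    by rewrite powRr1// invr_ge0 ltW.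
  move=> h; have c0 : 0 <= (2 * M) ^+ 2 * K * 2 `^ theta * Z.
    by rewrite !mulr_ge0// ?sqr_ge0// ltW.
  apply: (le_trans (ler_wpM2l c0 h)); rewrite le_eqVlt; apply/orP; left.
  by apply/eqP; field; rewrite !gt_eqF.
- by move=> s' t' D' s'0 t'T part' sz'; apply: IH.
- by rewrite Dn -ltnS.
Qed.

(** Greedy cutting: the longest initial piece below the threshold and the
    interval that follows it use up at least [sewing_scale theta K M] of the
    control. *)
Lemma oprod_le_iter (N : nat) s t D :
  0 <= s -> t <= T -> itv_partition s t D ->
  omega s t <= N%:R * sewing_scale theta K M ->
  `|oprod s D| <= 2 * M * (2 * M ^+ 2) ^+ N.
Proof.
have M0 : 0 <= M by move: M_ge1; lra.
have M2 : 1 <= 2 * M ^+ 2.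
  by have := @exprn_ege1 R 2 M M_ge1; lra.
set d := sewing_scale theta K M.
have d0 : 0 <= d by exact: powR_ge0.
elim: N s D => [|N IH] s D s0 tT part le.
  rewrite expr0 mulr1; apply: oprod_le_local part _ => //.
  by apply: le_trans le _; rewrite mul0r.
have [le_d|lt_d] := leP (omega s t) d.
  apply: (le_trans (oprod_le_local s0 tT part le_d)).
  by apply: ler_peMr; [lra|exact: exprn_ege1].
have [_ _ om0 omD] := omegaP.
have st := itv_partition_le part.
have [|| D1 [u [D2 [DE le1 lt2]]]] :=
  @split_first _ (fun u => omega s u <= d) s D.
- by rewrite om0// (le_trans st).
- by case: (part) => _ /eqP ->; rewrite -ltNge.
move: part; rewrite DE => /itv_partition_catP[part1].
move=> /itv_partition_consP[pu part2].
set p := last s D1 in le1 part1 pu *.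
have sp := itv_partition_le part1; have ut := itv_partition_le part2.
have u0 : 0 <= u by apply: le_trans (ltW pu); apply: le_trans sp.
rewrite oprod_cat /= -/p.
have -> : 2 * M * (2 * M ^+ 2) ^+ N.+1 =
  2 * M * (M * (2 * M * (2 * M ^+ 2) ^+ N)) by rewrite exprS; ring.
apply: bmul_norm_le.
  apply: oprod_le_local part1 le1 => //.
  exact: le_trans (ltW pu) (le_trans ut tT).
apply: bmul_norm_le.
  by apply: gam_le => //; [exact: le_trans sp|exact: le_trans tT].
apply: IH => //.
have := omD s u t s0 (le_trans sp (ltW pu)) ut tT.
by move: lt2 le; rewrite -ltNge -natr1 mulrDl mul1r; lra.
Qed.

Lemma oprod_le s t D : 0 <= s -> t <= T -> itv_partition s t D ->
  `|oprod s D| <= oprod_bound theta K M (omega 0 T).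
Proof.
move=> s0 tT part; apply: (oprod_le_iter s0 tT part).
have st := itv_partition_le part.
apply: (le_trans (control_mono omegaP (lexx 0) s0 st tT (lexx T))).
have M0 : 0 < M by exact: lt_le_trans M_ge1.
have d0 : 0 < sewing_scale theta K M.
  by rewrite powR_gt0// invr_gt0 !mulr_gt0// ?powR_gt0.
by rewrite -ler_pdivrMr// ltW// truncnS_gt.
Qed.

Local Notation L0 := (oprod_bound theta K M (omega 0 T)).
Local Notation C0 := (sewing_const theta K L0).

Let C0_ge0 : 0 <= C0.
Proof.
rewrite /sewing_const mulr_ge0 ?(ltW zeta_gt0)// mulr_ge0 ?powR_ge0//.
by rewrite mulr_ge0 ?sqr_ge0// ltW.
Qed.

Hypothesis gam_diag : forall s : R, 0 <= s -> s <= T -> gam s s = 1%B.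

Lemma sewing s t D : 0 <= s -> t <= T -> itv_partition s t D ->
  `|oprod s D - gam s t| <= C0 * omega s t `^ theta.
Proof.
move=> s0 tT part; have [D0|sz] := posnP (size D).
  move: part; rewrite (size0nil D0) => -[_ /eqP /= st].
  have tn0 : theta != 0 by rewrite gt_eqF// (lt_trans ltr01 theta_gt1).
  have [_ _ om0 _] := omegaP; subst t.
  by rewrite om0// gam_diag// subrr normr0 powR0// mulr0.
apply: (@sewing_of_bounded L0 (omega s t) (size D)) => //.
  by move=> s' t' D' s'0 t'T part' _ _; exact: (oprod_le s'0 t'T part').
by rewrite sz leqnn.
Qed.

(** The effect of refining [D] into [D']. The intervals of [D] are refined one
    at a time; the prefix [P] holds those that precede the current one, so that
    each error term is bounded with just two outer products, each at most
    [L0]. *)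
Lemma oprod_refine_le s0 P s t D D' eps :
  0 <= s0 -> itv_partition s0 s P -> t <= T ->
  itv_partition s t D -> itv_partition s t D' -> {subset D <= D'} ->
  path (fun x y => omega x y <= eps) s D ->
  `|oprod s0 (P ++ D') - oprod s0 (P ++ D)| <=
    L0 ^+ 2 * C0 * eps `^ (theta - 1) * omega s t.
Proof.
move=> s00; elim: D P s D' => [|u D IH] P s D' partP tT partD partD' sub.
  move: partD' partP => /= partD'; case: partD => _ /eqP /= st; subst t.
  rewrite (itv_partitionxx partD') subrr normr0 => partP _.
  have [_ _ -> //] := omegaP; first by rewrite mulr0.
  by rewrite (le_trans s00) ?(itv_partition_le partP).
move=> /= /andP[le_eps peps].
have uD' : u \in D' by apply: sub; rewrite mem_head.
case/splitPr: uD' sub partD' => D1 D2; rewrite -cat_rcons => sub.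
move=> /itv_partition_catP; rewrite last_rcons => -[part1 part2].
have /itv_partition_consP[su partu] := partD.
have [ss ut] := (itv_partition_le partP, itv_partition_le part2).
have sge0 := le_trans s00 ss; have uge0 := le_trans sge0 (ltW su).
have uT := le_trans ut tT.
have lastP : last s0 P = s by case: partP => _ /eqP.
have sub2 : {subset D <= D2}.
  move=> x xD; have /andP[ux _] := itv_partition_mem partu xD.
  have : x \in rcons D1 u ++ D2 by apply: sub; rewrite inE xD orbT.
  rewrite mem_cat => /orP[/(itv_partition_mem part1)/andP[_]|//].
  by rewrite leNgt ux.
have partPu : itv_partition s0 u (rcons P u).
  rewrite -cats1; apply/itv_partition_catP; rewrite lastP; split => //.
  by apply/itv_partition_consP; split => //; split.
have := IH _ _ _ partPu tT partu part2 sub2 peps; rewrite !cat_rcons => le2.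
have le1 : `|oprod s0 (P ++ D1 ++ u :: D2) - oprod s0 (P ++ u :: D2)| <=
    L0 ^+ 2 * C0 * eps `^ (theta - 1) * omega s u.
  rewrite -cat_rcons !oprod_cat lastP -bmulBr last_rcons /= -bmulBl.
  have -> : L0 ^+ 2 * C0 * eps `^ (theta - 1) * omega s u =
    L0 * (C0 * (omega s u * eps `^ (theta - 1)) * L0) by ring.
  apply: bmul_norm_le; first exact: oprod_le s00 (le_trans (ltW su) uT) partP.
  apply: bmul_norm_le; last exact: oprod_le uge0 tT part2.
  apply: (le_trans (sewing sge0 uT part1)).
  have om0 := omega_ge0 sge0 (ltW su) uT.
  apply: ler_wpM2l; first exact: C0_ge0.
  rewrite -mulr_powRB1//; last exact: lt_trans theta_gt1.
  apply: ler_wpM2l => //; apply: ge0_ler_powR => //.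
  - by rewrite subr_ge0 ltW.
  - by rewrite nnegrE (le_trans om0).
apply: (le_trans (ler_distD (oprod s0 (P ++ u :: D2)) _ _)).
apply: (le_trans (lerD le1 le2)); rewrite -mulrDr.
have [_ _ _ omD] := omegaP.
apply: ler_wpM2l; last exact: omD (ltW su) ut tT.
by rewrite mulr_ge0 ?powR_ge0// mulr_ge0 ?sqr_ge0// C0_ge0.
Qed.

(** Cauchy criterion: two fine partitions are compared through a common
    refinement. *)
Lemma oprod_fine_dist s t e : 0 <= s -> s <= t -> t <= T -> 0 < e ->
  exists2 d : R, 0 < d & forall D D',
    itv_partition s t D -> mesh s D < d ->
    itv_partition s t D' -> mesh s D' < d ->
    `|oprod s D - oprod s D'| < e.
Proof.
move=> s0 st tT e0; pose c := L0 ^+ 2 * C0 * omega s t + 1.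
have om0 := omega_ge0 s0 st tT.
have c0 : 0 < c.
  by rewrite ltr_wpDl// mulr_ge0 ?om0// mulr_ge0 ?sqr_ge0 ?C0_ge0.
(* [eps] is chosen so that each refinement costs at most [e / 3]. *)
pose q := e / (3 * c).
have q0 : 0 < q by rewrite divr_gt0// mulr_gt0.
pose eps := q `^ (theta - 1)^-1.
have eps0 : 0 < eps by rewrite powR_gt0.
have epsE : eps `^ (theta - 1) = q.
  rewrite -powRrM mulVf ?powRr1 ?ltW// gt_eqF// subr_gt0//.
have [d d0 small] := control_small omegaP eps0.
exists d => //.
have fine D : forall s', 0 <= s' -> itv_partition s' t D -> mesh s' D < d ->
    path (fun x y => omega x y <= eps) s' D.
  elim: D => [//|u D IH] s' s'0 part.
  rewrite mesh_lt//= -mesh_lt// => /andP[us pD].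
  have [su partu] := (itv_partition_consP s' t u D).1 part.
  have ut := itv_partition_le partu.
  rewrite IH ?(le_trans s'0 (ltW su))// andbT.
  apply: small => //; [exact: ltW|exact: le_trans tT|].
  by apply: le_lt_trans us; exact: ler_norm.
have close D D'' : itv_partition s t D -> mesh s D < d ->
    itv_partition s t D'' -> {subset D <= D''} ->
    `|oprod s D'' - oprod s D| <= e / 3.
  move=> part me part'' sub.
  have partnil : itv_partition s s [::] by split.
  have small_eps := fine _ _ s0 part me.
  apply: (le_trans (oprod_refine_le s0 partnil tT part part'' sub small_eps)).
  rewrite epsE -mulrA (mulrC q) mulrA.
  have -> : e / 3 = c * q by rewrite /q; field; rewrite gt_eqF.
  by apply: ler_wpM2r; [exact: ltW|rewrite /c; lra].
move=> D D' part me part' me'.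
have [D'' [part'' sub sub']] := itv_partition_common part part'.
apply: (le_lt_trans (ler_distD (oprod s D'') _ _)).
have := close D D'' part me part'' sub; rewrite distrC.
by have := close D' D'' part' me' part'' sub'; lra.
Qed.

(** The limit of the products as the mesh of the partitions of [[s, t]] tends to
    0: the multiplicative integral of [gam]. *)
Definition oprod_lim s t : A := lim (oprod s @ mesh_to0 s t).

Lemma oprod_cvg s t : 0 <= s -> s <= t -> t <= T ->
  cvg (oprod s @ mesh_to0 s t).
Proof.
move=> s0 st tT; have pF := mesh_to0_proper st.
apply/cauchy_cvgP; apply: cauchy_exP => e e0.
have [d d0 h] := oprod_fine_dist s0 st tT e0.
have [D [part me]] := itv_partition_fine st d0.
exists (oprod s D); exists d => // D' [part' me'].
by rewrite -ball_normE /=; apply: h.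
Qed.

Lemma oprod_lim_approx s t e : 0 <= s -> s <= t -> t <= T -> 0 < e ->
  exists2 d : R, 0 < d & forall D, itv_partition s t D -> mesh s D < d ->
    `|oprod_lim s t - oprod s D| <= e.
Proof.
move=> s0 st tT e0; have pF := mesh_to0_proper st.
have /cvgrPdist_le/(_ _ e0)[d d0 h] := oprod_cvg s0 st tT.
by exists d => // D part me; apply: h.
Qed.

Lemma oprod_lim_sewing s t : 0 <= s -> s <= t -> t <= T ->
  `|oprod_lim s t - gam s t| <= C0 * omega s t `^ theta.
Proof.
move=> s0 st tT; apply/ler_addgt0Pr => e e0.
have [d d0 h] := oprod_lim_approx s0 st tT e0.
have [D [part me]] := itv_partition_fine st d0.
apply: (le_trans (ler_distD (oprod s D) _ _)).
by rewrite addrC; apply: lerD; [exact: sewing|exact: h].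
Qed.

(** Integrals from 0 up to two times [t] and [t'], compared through partitions
    that pass through a common point [s] and agree before it. *)
Lemma oprod_lim_dist s t t' :
  0 <= s -> s <= t -> t <= T -> s <= t' -> t' <= T ->
  `|oprod_lim 0 t - oprod_lim 0 t'| <= L0 *
    (C0 * omega s t `^ theta + C0 * omega s t' `^ theta +
      `|gam s t - gam s t'|).
Proof.
move=> s0 st tT st' t'T; apply/ler_addgt0Pr => e e0.
have e20 : 0 < e / 2 by rewrite divr_gt0.
have sT := le_trans st tT.
have [d d0 h] := oprod_lim_approx (lexx 0) (le_trans s0 st) tT e20.
have [d' d'0 h'] := oprod_lim_approx (lexx 0) (le_trans s0 st') t'T e20.
pose m := Num.min d d'; have m0 : 0 < m by rewrite lt_min d0.
have [P [partP mP]] := itv_partition_fine s0 m0.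
have [D [partD mD]] := itv_partition_fine st m0.
have [D' [partD' mD']] := itv_partition_fine st' m0.
have lastP : last 0 P = s by case: partP => _ /eqP.
have mcat E : mesh s E < m -> mesh 0 (P ++ E) < m.
  by rewrite !mesh_lt// cat_path lastP => ->; rewrite -mesh_lt// mP.
have := mcat _ mD; rewrite lt_min => /andP[{}mD _].
have := mcat _ mD'; rewrite lt_min => /andP[_ {}mD'].
have {}h := h _ ((itv_partition_catP 0 t P D).2 _) mD.
have {}h' := h' _ ((itv_partition_catP 0 t' P D').2 _) mD'.
rewrite lastP in h h'.
have {h}le1 := h (conj partP partD); have {h'}le2 := h' (conj partP partD').
have le3 : `|oprod 0 (P ++ D) - oprod 0 (P ++ D')| <= L0 *
    (C0 * omega s t `^ theta + C0 * omega s t' `^ theta +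
      `|gam s t - gam s t'|).
  rewrite !oprod_cat lastP -bmulBr; apply: bmul_norm_le.
    exact: oprod_le (lexx 0) sT partP.
  have := sewing s0 tT partD; have := sewing s0 t'T partD'.
  rewrite (distrC (oprod s D')) => a b.
  apply: (le_trans (ler_distD (gam s t) _ _)).
  have := ler_distD (gam s t') (gam s t) (oprod s D'); lra.
apply: (le_trans (ler_distD (oprod 0 (P ++ D)) _ _)).
have := ler_distD (oprod 0 (P ++ D')) (oprod 0 (P ++ D)) (oprod_lim 0 t').
rewrite (distrC (oprod 0 (P ++ D')) (oprod_lim 0 t')); lra.
Qed.

(** The continuity of each [gam s] is enough; joint continuity is not needed. *)
Lemma oprod_lim_continuous :
  (forall s, 0 <= s -> s <= T -> {within `[0, T], continuous (gam s)}) ->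
  {within `[0, T], continuous (oprod_lim 0)}.
Proof.
move=> gamc; apply/subspace_continuousP => t.
rewrite /= in_itv /= => /andP[t0 tT]; apply/cvgrPdist_le => e e0.
rewrite near_withinE.
have L00 : 0 <= L0.
  have part0 : itv_partition (0 : R) 0 [::] by split.
  exact: le_trans (normr_ge0 _) (oprod_le (lexx 0) (le_trans t0 tT) part0).
pose c := 3 * (L0 + 1) * (C0 + 1).
have c0 : 0 < c by rewrite !mulr_gt0// ltr_wpDl.
pose eps := (e / c) `^ theta^-1.
have eps0 : 0 < eps by rewrite powR_gt0// divr_gt0.
have [d d0 small] := control_small omegaP eps0.
(* The base point [s] lies to the left of both [t] and the nearby times [t'],
   unless it is 0. *)
pose s := Num.max 0 (t - d / 3).
have s0 : 0 <= s by rewrite le_max lexx.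
have st : s <= t by rewrite ge_max t0; lra.
have sT := le_trans st tT.
have /subspace_continuousP/(_ t) := gamc s s0 sT.
rewrite /= in_itv /= t0 tT => /(_ isT)/cvgrPdist_le.
have e20 : 0 < e / (3 * (L0 + 1)) by rewrite divr_gt0// mulr_gt0// ltr_wpDl.
move=> /(_ _ e20); rewrite near_withinE => near1.
have near2 : \forall t' \near t, `|t - t'| < d / 3.
  by apply/nbhs_ballP; exists (d / 3) => //=; rewrite divr_gt0.
near=> t' => /=; rewrite in_itv /= => /andP[t'0 t'T].
have tt' : `|t - t'| < d / 3 by near: t'.
have st' : s <= t'.
  by rewrite ge_max t'0; have := ler_norm (t - t'); lra.
have std u : u < t + d / 3 -> u - s < d.
  have : t - d / 3 <= s by rewrite le_max lexx orbT.
  by lra.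
have omle u : s <= u -> u <= T -> u < t + d / 3 ->
    C0 * omega s u `^ theta <= e / (3 * (L0 + 1)).
  move=> su uT ud; have om := small s u s0 su uT (std u ud).
  have : omega s u `^ theta <= eps `^ theta.
    apply: ge0_ler_powR => //; rewrite nnegrE ?(ltW eps0)//.
    exact: omega_ge0.
  rewrite -powRrM mulVf ?(gt_eqF (lt_trans ltr01 theta_gt1))//.
  rewrite powRr1 ?(divr_ge0 (ltW e0) (ltW c0))// => om'.
  apply: (le_trans (ler_wpM2l C0_ge0 om')).
  have -> : e / (3 * (L0 + 1)) = (C0 + 1) * (e / c).
    by rewrite /c; field; rewrite !gt_eqF ?ltr_wpDl.
  by apply: ler_wpM2r; [exact: divr_ge0 (ltW e0) (ltW c0)|rewrite lerDl].
have le1 := omle t st tT _.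
have le2 := omle t' st' t'T _.
have le3 : `|gam s t - gam s t'| <= e / (3 * (L0 + 1)).
  move: t'0 t'T; near: t'; apply: filterS near1 => t' h t'0 t'T; apply: h.
  by rewrite /= in_itv /= t'0.
apply: (le_trans (oprod_lim_dist s0 st tT st' t'T)).
have -> : e = (L0 + 1) * (3 * (e / (3 * (L0 + 1)))).
  by field; rewrite gt_eqF// ltr_wpDl.
apply: ler_pM => //.
- by rewrite !addr_ge0// mulr_ge0// powR_ge0.
- by rewrite lerDl.
have {}le1 : C0 * omega s t `^ theta <= e / (3 * (L0 + 1)) by apply: le1; lra.
have {}le2 : C0 * omega s t' `^ theta <= e / (3 * (L0 + 1)).
  by apply: le2; have := ler_norm (t' - t); rewrite (distrC t' t); lra.
lra.
Unshelve. all: by end_near. Qed.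

End Sewing.

(** * Cocyclic one-forms *)

Section CocyclicForms.
Variables (R : realType).

Lemma group_binv (A : banachAlgType R) (G : set A) (a : A) :
  topological_group G -> G a ->
  [/\ G (a^-1)%B, (a * a^-1)%B = 1%B & (a^-1 * a)%B = 1%B].
Proof.
move=> [_ _ Ginv _ _] Ga; have [b Gb ab] := Ginv a Ga.
have [aV Va] := @xgetPex _ 0 (binverse a) (ex_intro _ b ab).
rewrite -/(binv a) in aV Va; split => //.
suff -> : (a^-1)%B = b by [].
by rewrite -[LHS]bmul1r -ab.1 bmulA Va bmul1l.
Qed.

(** The cocycle identity makes [beta a 1] an idempotent of a group. *)
Lemma cocyclic1 (A B : banachAlgType R) (G : set A) (K : set B)
    (beta : A -> {linear A -> B}) (a : A) :
  topological_group G -> topological_group K -> cocyclic G K beta -> G a ->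
  beta a 1%B = 1%B.
Proof.
move=> Gg Kg [_ Kbeta cocycle] Ga; have [G1 _ _ _ _] := Gg.
have [_ pV Vp] := group_binv Kg (Kbeta a 1%B Ga G1).
have := cocycle a 1%B 1%B Ga G1 G1; rewrite !bmul1r => pp.
by rewrite -[LHS]bmul1l -Vp -bmulA pp.
Qed.

Lemma riemann_prodE (A B : banachAlgType R) (beta : R -> A -> {linear A -> B})
    (g : R -> A) (s : R) (D : seq R) :
  riemann_prod beta g s D =
    oprod (fun u v => beta u (g u) (increment g u v)) s D.
Proof.
rewrite /riemann_prod; elim: D s => [|u D IH] s; first by rewrite big_geq.
by rewrite /= big_nat_recl//= -IH.
Qed.

Lemma oprod_group (A : banachAlgType R) (G : set A) (gam : R -> R -> A)
    (s t : R) (D : seq R) :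
  topological_group G ->
  (forall u v, s <= u -> u < v -> v <= t -> G (gam u v)) ->
  itv_partition s t D -> G (oprod gam s D).
Proof.
move=> [G1 GM _ _ _]; elim: D s => [//|u D IH] s Ggam.
move=> /itv_partition_consP[su ut].
apply: GM; first by apply: Ggam => //; exact: itv_partition_le ut.
by apply: IH => // v w uv; apply: Ggam; exact: le_trans (ltW su) uv.
Qed.

End CocyclicForms.

(** * Norms on the tensor triple *)

Section TensorTriple.
Variables (R : realType) (V : completeNormedModType R) (E : tensor_powers V).
Variables (n : nat) (X : tensor_triple E n).
Implicit Types a b : talg X.

(** The algebra carries the l^1 norm of the tensor powers, so the injections
    are isometric. *)
Lemma norm_tin (k : 'I_n.+1) (x : tensor E k) : `|tin X k x| = `|x|.
Proof.
rewrite talg_norm (bigD1 k)//= big1 ?addr0; first by rewrite tpr_in// -ltnS.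
move=> j jk; rewrite tpr_in0 ?normr0// -1?ltnS//.
by move=> jk'; move/eqP: jk; apply; apply/val_inj.
Qed.

Lemma tsig_le_max_sig (s : tidx X) a : `|tsig s a| <= max_sig a.
Proof. exact: (le_bigmax _ (fun s => `|tsig s a|)). Qed.

Lemma norm_le_max_sig a : `|a| <= #|tidx X|%:R * max_sig a.
Proof.
rewrite [in leLHS](tsig_sum a); apply: (le_trans (ler_norm_sum _ _ _)).
rewrite mulr_natl -sumr_const; apply: ler_sum => s _.
by rewrite norm_tin; exact: tsig_le_max_sig.
Qed.

Lemma tsig_bounded : exists2 c : R, 0 <= c &
  forall a b, max_sig_dist a b <= c * `|a - b|.
Proof.
have bnd (s : tidx X) :
    exists c : R, 0 <= c /\ forall a, `|tsig s a| <= c * `|a|.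
  have /linear_bounded_continuous/linear_boundedP h :=
    @tsig_continuous _ _ _ _ X s.
  have [c [c0 hc]] := filter_ex (filterI (nbhs_pinfty_ge (num_real 0)) h).
  by exists c.
have [c cP] := choice bnd.
have c0 : 0 <= \sum_s c s by apply: sumr_ge0 => s _; case: (cP s).
exists (\sum_s c s) => // a b; apply: bigmax_le => [|s _].
  by rewrite mulr_ge0.
rewrite -linearB; apply: (le_trans ((cP s).2 _)); apply: ler_wpM2r => //.
by rewrite (bigD1 s)//= lerDl sumr_ge0// => s' _; case: (cP s').
Qed.

End TensorTriple.

(** * Existence and estimate of the integral *)

Theorem theorem15 (R : realType) (V : completeNormedModType R)
    (E : tensor_powers V) (n : nat) (X : tensor_triple E n) :
  exists C : R -> R -> R -> R,
  forall (B : banachAlgType R) (H : set B) (T : R) (g : R -> B)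
    (beta : R -> B -> {linear B -> talg X})
    (M : R) (omega : R -> R -> R) (theta : R),
  topological_group H ->
  0 <= T ->
  group_path H T g ->
  cocyclic_path H (tgrp X) T beta ->
  0 < M ->
  control T omega ->
  1 < theta ->
  (forall s t, 0 <= s -> s < t -> t <= T ->
     max_sig (beta s (g s) (increment g s t)) <= M) ->
  (forall s u t, 0 <= s -> s < u -> u < t -> t <= T ->
     max_sig (beta u (g u) (increment g u t) - beta s (g u) (increment g u t))
       <= omega s t `^ theta) ->
  [/\ forall s t, 0 <= s -> s < t -> t <= T -> integrable_form beta g s t,
      group_path (tgrp X) T (fun t => form_integral beta g 0 t) &
      forall s t, 0 <= s -> s < t -> t <= T ->
        max_sig_dist (form_integral beta g s t) (beta s (g s) (increment g s t))
          <= C theta M (omega 0 T) * omega s t `^ theta].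
Proof.
have [c c0 max_sig_le] := tsig_bounded X.
pose m : R := #|tidx X|%:R; have m0 : 0 <= m by exact: ler0n.
(* [M' M] bounds the norms of the increments and of the unit; [K M] is the
   constant of almost multiplicativity. *)
pose M' M := m * M + `|1%B : talg X| + 1.
pose K M := M' M * (m + 1).
exists (fun theta M W =>
  c * sewing_const theta (K M) (oprod_bound theta (K M) (M' M) W)).
move=> B H T g beta M omega theta Hgrp _ [gH gc] [betaP _] M0 omegaP th1.
move=> bndM bndO.
pose gam s t := beta s (g s) (increment g s t).
have tgrpP := tgrp_group X.
have itvT s : 0 <= s -> s <= T -> s \in `[0, T].
  by move=> s0 sT; rewrite in_itv /= s0.
have gin s : 0 <= s -> s <= T -> H (g s) by move=> s0 sT; apply/gH/itvT.
have incH s t : 0 <= s -> s <= T -> 0 <= t -> t <= T -> H (increment g s t).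
  move=> s0 sT t0 tT; have [Hinv _ _] := group_binv Hgrp (gin s s0 sT).
  by case: Hgrp => _ HM _ _ _; apply: HM => //; exact: gin.
have M'ge1 : 1 <= M' M by rewrite /M' lerDr addr_ge0// mulr_ge0// ltW.
have K0 : 0 < K M by rewrite mulr_gt0 ?(lt_le_trans ltr01 M'ge1)// ltr_wpDl.
have one_le : `|1%B : talg X| <= M' M.
  by rewrite /M' addrAC lerDr addr_ge0// mulr_ge0// ltW.
have gam_le s t : 0 <= s -> s < t -> t <= T -> `|gam s t| <= M' M.
  move=> s0 st tT; apply: (le_trans (norm_le_max_sig _)).
  apply: (@le_trans _ _ (m * M)); first by rewrite ler_wpM2l ?bndM.
  by rewrite /M' -addrA lerDl addr_ge0.
have gam_almost s u t : 0 <= s -> s < u -> u < t -> t <= T ->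
    `|(gam s u * gam u t)%B - gam s t| <= K M * omega s t `^ theta.
  move=> s0 su ut tT.
  have u0 := le_trans s0 (ltW su); have t0 := le_trans u0 (ltW ut).
  have uT := le_trans (ltW ut) tT; have sT := le_trans (ltW su) uT.
  have [_ gV Vg] := group_binv Hgrp (gin s s0 sT).
  have [_ gVu _] := group_binv Hgrp (gin u u0 uT).
  have [_ _ cocycle] := betaP s (itvT s s0 sT).
  have gu : (g s * increment g s u)%B = g u.
    by rewrite /increment bmulA gV bmul1l.
  have inc : (increment g s u * increment g u t)%B = increment g s t.
    by rewrite /increment -bmulA (bmulA (g u)) gVu bmul1l.
  have := cocycle (g s) (increment g s u) (increment g u t)
    (gin s s0 sT) (incH s u s0 sT u0 uT) (incH u t u0 uT t0 tT).
  rewrite gu inc -/(gam s t) => <-; rewrite -bmulBr /K -mulrA.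
  apply: bmul_norm_le; first exact: gam_le.
  apply: (le_trans (norm_le_max_sig _)).
  apply: ler_pM => //; last exact: bndO.
    by apply: le_trans (tsig_le_max_sig (tidx0 X) _); exact: normr_ge0.
  by rewrite lerDl.
have gam_diag s : 0 <= s -> s <= T -> gam s s = 1%B.
  move=> s0 sT; rewrite /gam /increment.
  have [_ _ ->] := group_binv Hgrp (gin s s0 sT).
  exact: cocyclic1 Hgrp tgrpP (betaP s (itvT s s0 sT)) (gin s s0 sT).
have gam_continuous s : 0 <= s -> s <= T ->
  {within `[0, T], continuous (gam s)}.
  move=> s0 sT; apply/subspace_continuousP => t tT.
  have [[bc _] _ _] := betaP s (itvT s s0 sT).
  have gct : g u @[u --> within `[0, T] (nbhs t)] --> g t.
    by move/subspace_continuousP: gc; apply.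
  have inc : increment g s u @[u --> within `[0, T] (nbhs t)] -->
      increment g s t by apply: cvg_comp gct _; exact: bmul_continuousr.
  by apply: cvg_comp inc _; exact: (bc (g s) (gin s s0 sT)).
have prodE s : riemann_prod beta g s = oprod gam s.
  by apply/funext => D; exact: riemann_prodE.
have integralE s t : form_integral beta g s t = oprod_lim gam s t.
  by rewrite /form_integral prodE.
have oprod_cvg s t : 0 <= s -> s <= t -> t <= T ->
  cvg (oprod gam s @ mesh_to0 s t).
  exact: (oprod_cvg omegaP th1 M'ge1 K0 one_le gam_le gam_almost gam_diag).
split.
- move=> s t s0 st tT; rewrite /integrable_form.
  by rewrite prodE; exact: oprod_cvg s0 (ltW st) tT.
- split.
    move=> t; rewrite in_itv /= => /andP[t0 tT]; rewrite integralE.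
    have pF := mesh_to0_proper t0.
    apply: (@closed_cvg _ _ _ pF (oprod gam 0) _ (@tgrp_closed _ _ _ _ X) _ _
      (oprod_cvg 0 t (lexx 0) t0 tT)).
    exists 1 => //= D [part _]; apply: oprod_group tgrpP _ part => u v u0 uv vt.
    have vT := le_trans vt tT; have uT := le_trans (ltW uv) vT.
    have [_ + _] := betaP u (itvT u u0 uT); apply; first exact: gin.
    by apply: incH => //; exact: le_trans (ltW uv).
  rewrite (_ : (fun t => _) = oprod_lim gam 0); last by apply/funext => t.
  exact: (oprod_lim_continuous omegaP th1 M'ge1 K0 one_le gam_le gam_almost).
- move=> s t s0 st tT; rewrite integralE -/(gam s t).
  apply: (le_trans (max_sig_le _ _)); rewrite -mulrA; apply: ler_wpM2l => //.
  exact: (oprod_lim_sewing omegaP th1 M'ge1 K0 one_le gam_le gam_almost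
    gam_diag s0 (ltW st) tT).
Qed.
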